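(* Let $D\subseteq\mathbb{R}^m$ and $\tilde{D}\subseteq\mathbb{R}^n$ be domains with weight functions $\omega$ on $D$ and $\tilde{\omega}$ on $\tilde{D}$, and let $d_\omega$ and $d_{\tilde{\omega}}$ be the distances generated by $\omega$ and $\tilde{\omega}$ on $D$ and $\tilde{D}$, respectively. Let $f\in\mathcal{C}^1(D,\tilde{D})$, and let $\Omega_f$ be any admissible function for the mapping $f$ with respect to $\omega$ and $\tilde{\omega}$. If one of the numbers $$\mathbf{B}_f=\sup_{x\in D}\frac{\tilde{\omega}(f(x))}{\omega(x)}\,\|D_f(x)\|\qquad\text{and}\qquad \mathbf{L}_f=\sup_{x,y\in D,\;x\neq y}\Omega_f(x,y)\,\frac{|f(x)-f(y)|}{|x-y|}$$ is finite, then both numbers are finite, and these numbers are equal.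
   Context: $|\cdot|$ is the Euclidean norm. $\mathcal{C}^1(D,\tilde{D})$ is the class of all continuously differentiable mappings $f:D\to\tilde{D}$. $D_f(x):\mathbb{R}^m\to\mathbb{R}^n$ denotes the differential of $f$ at $x$, and $\|D_f(x)\|=\sup_{|\zeta|=1}|D_f(x)\zeta|$ is its operator norm. A weight function on a domain is an everywhere positive and continuous function on it. For a weight function $\omega$ on a domain $D\subseteq\mathbb{R}^m$, the $\omega$-distance is $$d_\omega(x,y)=\inf_\gamma\int_\gamma\omega(z)\,|dz|,\qquad x,y\in D,$$ where the infimum is over all piecewise $\mathcal{C}^1$-curves $\gamma\subseteq D$ connecting $x$ and $y$; $d_{\tilde{\omega}}$ on $\tilde{D}$ is defined in the same way. Given weight functions $\omega$ on $D$ and $\tilde{\omega}$ on $\tilde{D}$ and a mapping $f\in\mathcal{C}^1(D,\tilde{D})$, an everywhere positive function $\Omega_f$ on $D\times D$ is called admissible for $f$ with respect to $\omega$ and $\tilde{\omega}$ if the following conditions are satisfied: 1. $\Omega_f(x,y)=\Omega_f(y,x)$ for all $x,y\in D$; 2. $\Omega_f(x,x)=\dfrac{\tilde{\omega}(f(x))}{\omega(x)}$ for all $x\in D$; 3. $\liminf_{z\to x}\Omega_f(x,z)\ge\Omega_f(x,x)$ for all $x\in D$; 4. $\Omega_f(x,y)\,\dfrac{|f(x)-f(y)|}{|x-y|}\le\dfrac{d_{\tilde{\omega}}(f(x),f(y))}{d_\omega(x,y)}$ for all $x,y\in D$ with $x\neq y$. *)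

(* Defs.v *)
From HB Require Import structures.
From mathcomp Require Import all_boot all_order all_algebra.
From mathcomp Require Import all_classical all_reals all_analysis.

Set Implicit Arguments.
Unset Strict Implicit.
Unset Printing Implicit Defensive.

Import Order.TTheory GRing.Theory Num.Theory.
Import numFieldNormedType.Exports.

Local Open Scope classical_set_scope.
Local Open Scope ring_scope.

(* The library norm `|x| on row vectors is the sup norm. It generates the same
   topology, limits and differentials as the Euclidean norm, so the library
   notions are used for those, and [enorm] wherever a length is measured. *)
Definition enorm (R : realType) (m : nat) (x : 'rV[R]_m) : R :=
  Num.sqrt (\sum_(i < m) x 0 i ^+ 2).

Definition is_domain (R : realType) (m : nat) (D : set 'rV[R]_m) : Prop :=
  [/\ D !=set0, open D & connected D].

Definition weight_function (R : realType) (m : nat) (D : set 'rV[R]_m)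
    (w : 'rV[R]_m -> R) : Prop :=
  (forall x, D x -> 0 < w x) /\ {within D, continuous w}.

(* Functions are total in Rocq: only the values of [f] on [D] matter, since [D]
   is open. The continuity of the differential is that of its matrix. *)
Definition C1_map (R : realType) (m n : nat) (D : set 'rV[R]_m)
    (D' : set 'rV[R]_n) (f : 'rV[R]_m -> 'rV[R]_n) : Prop :=
  [/\ forall x, D x -> D' (f x),
      forall x, D x -> differentiable f x
    & {within D, continuous (fun x => jacobian f x)}].

Definition opnorm (R : realType) (m n : nat) (A : 'rV[R]_m -> 'rV[R]_n) : R :=
  sup [set enorm (A z) | z in [set z : 'rV[R]_m | enorm z = 1]].

(* For g continuous on [c, d], being C^1 on the closed interval amounts to
   being differentiable inside, with a derivative that extends continuously to
   the end points (this gives the one-sided derivatives there). *)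
Definition C1_piece (R : realType) (m : nat) (c d : R) (g : R -> 'rV[R]_m) :
    Prop :=
  (forall t, t \in `]c, d[ -> derivable g t 1) /\
  (exists2 h : R -> 'rV[R]_m, {within `[c, d], continuous h} &
     forall t, t \in `]c, d[ -> derive1 g t = h t).

(* The break points are a :: s, with last element b. *)
Definition piecewise_C1 (R : realType) (m : nat) (a b : R)
    (g : R -> 'rV[R]_m) : Prop :=
  {within `[a, b], continuous g} /\
  (exists2 s : seq R, itv_partition a b s &
     forall i : nat, (i < size s)%N ->
       C1_piece (nth a (a :: s) i) (nth a (a :: s) i.+1) g).

Definition curve_connecting (R : realType) (m : nat) (D : set 'rV[R]_m)
    (x y : 'rV[R]_m) (a b : R) (g : R -> 'rV[R]_m) : Prop :=
  [/\ a <= b, piecewise_C1 a b g, forall t, t \in `[a, b] -> D (g t),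
      g a = x & g b = y].

(* The derivative has an arbitrary value at the finitely many break points where
   it does not exist; this does not affect the integral. *)
Definition weighted_length (R : realType) (m : nat) (w : 'rV[R]_m -> R)
    (a b : R) (g : R -> 'rV[R]_m) : R :=
  \int[@lebesgue_measure R]_(t in `[a, b]) (w (g t) * enorm (derive1 g t)).

(* For x and y in a domain, the set of lengths is nonempty and bounded below by
   0, so the real-valued [inf] is the genuine infimum. *)
Definition wdist (R : realType) (m : nat) (D : set 'rV[R]_m)
    (w : 'rV[R]_m -> R) (x y : 'rV[R]_m) : R :=
  inf [set l : R | exists a b (g : R -> 'rV[R]_m),
         curve_connecting D x y a b g /\ l = weighted_length w a b g].

Record admissible (R : realType) (m n : nat)
    (D : set 'rV[R]_m) (w : 'rV[R]_m -> R)
    (D' : set 'rV[R]_n) (w' : 'rV[R]_n -> R)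
    (f : 'rV[R]_m -> 'rV[R]_n) (Om : 'rV[R]_m -> 'rV[R]_m -> R) : Prop :=
  Admissible {
    admissible_gt0 : forall x y, D x -> D y -> 0 < Om x y;
    admissible_sym : forall x y, D x -> D y -> Om x y = Om y x;
    admissible_diag : forall x, D x -> Om x x = w' (f x) / w x;
    admissible_liminf : forall x, D x ->
      ((Om x x)%:E <= limf_einf (fun z => (Om x z)%:E) (within D (dnbhs x)))%E;
    admissible_dist : forall x y, D x -> D y -> x <> y ->
      Om x y * (enorm (f x - f y) / enorm (x - y)) <=
      wdist D' w' (f x) (f y) / wdist D w x y
  }.

Definition Bnum (R : realType) (m n : nat)
    (D : set 'rV[R]_m) (w : 'rV[R]_m -> R) (w' : 'rV[R]_n -> R)
    (f : 'rV[R]_m -> 'rV[R]_n) : \bar R :=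
  ereal_sup [set (w' (f x) / w x * opnorm ('d f x))%:E | x in D].

Definition Lnum (R : realType) (m n : nat)
    (D : set 'rV[R]_m) (f : 'rV[R]_m -> 'rV[R]_n)
    (Om : 'rV[R]_m -> 'rV[R]_m -> R) : \bar R :=
  ereal_sup [set (Om p.1 p.2 * (enorm (f p.1 - f p.2) / enorm (p.1 - p.2)))%:E
            | p in [set p : 'rV[R]_m * 'rV[R]_m |
                    [/\ D p.1, D p.2 & p.1 <> p.2]]].

(* Main.v *)
(* Letting y tend to x along a ray from x turns the quotients in L_f into
   directional derivatives, and the lower semicontinuity of Omega_f at the
   diagonal gives B_f <= L_f. Conversely, the chain rule bounds the
   omega'-length of the image of a curve by B_f times its omega-length, so that
   d_omega'(f x, f y) <= B_f d_omega(x, y), and the last condition on Omega_f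
   gives L_f <= B_f. *)
Require Import Defs.
From HB Require Import structures.
From mathcomp Require Import all_boot all_order all_algebra.
From mathcomp Require Import all_classical all_reals all_analysis.
From mathcomp Require Import measurable_realfun.
Import Order.TTheory GRing.Theory Num.Theory.
Import numFieldNormedType.Exports.
Local Open Scope classical_set_scope.
Local Open Scope ring_scope.

Set Implicit Arguments.
Unset Strict Implicit.

(** * The Euclidean norm and the operator norm *)

Lemma cvg_sum (R : realType) (T : Type) (F : set_system T) {FF : Filter F}
    (I : finType) (g : I -> T -> R) (a : I -> R) :
  (forall i, g i @ F --> a i) ->
  (fun t => \sum_i g i t) @ F --> \sum_i a i.
Proof.
move=> ga; apply: cvg_big => [|i _]; last exact: ga.
exact: (@add_continuous R^o).
Qed.

Lemma enorm_ge0 (R : realType) m (x : 'rV[R]_m) : 0 <= enorm x.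
Proof. exact: sqrtr_ge0. Qed.

Lemma normr_coord_le_enorm (R : realType) m (x : 'rV[R]_m) i :
  `|x 0 i| <= enorm x.
Proof.
rewrite -sqrtr_sqr ler_wsqrtr// (bigD1 i)//= lerDl.
by apply: sumr_ge0 => j _; exact: sqr_ge0.
Qed.

Lemma enorm_gt0 (R : realType) m (x : 'rV[R]_m) : x != 0 -> 0 < enorm x.
Proof.
move=> x0; rewrite lt_neqAle enorm_ge0 andbT eq_sym.
apply: contra x0 => /eqP x0; apply/eqP/rowP => i; apply/eqP.
by rewrite mxE -normr_le0 -x0 normr_coord_le_enorm.
Qed.

Lemma enormZ (R : realType) m (a : R) (x : 'rV[R]_m) :
  enorm (a *: x) = `|a| * enorm x.
Proof.
rewrite /enorm -sqrtr_sqr -sqrtrM ?sqr_ge0//; congr Num.sqrt.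
by rewrite mulr_sumr; apply: eq_bigr => i _; rewrite mxE exprMn.
Qed.

Lemma enorm0 (R : realType) m : enorm (0 : 'rV[R]_m) = 0.
Proof. by rewrite -[X in enorm X](scale0r 0) enormZ normr0 mul0r. Qed.

Lemma enorm1_neq0 (R : realType) m (x : 'rV[R]_m) : enorm x = 1 -> x != 0.
Proof.
by apply: contra_eq_neq => ->; rewrite enorm0 eq_sym oner_neq0.
Qed.

Lemma enormB (R : realType) m (x y : 'rV[R]_m) : enorm (x - y) = enorm (y - x).
Proof. by rewrite -opprB -scaleN1r enormZ normrN1 mul1r. Qed.

Lemma enorm_continuous (R : realType) m : continuous (@enorm R m).
Proof.
move=> x; apply: continuous_comp; last exact: sqrt_continuous.
apply: (@cvg_sum _ _ (nbhs x)) => i.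
apply: (@continuous_comp _ _ _ (fun z : 'rV[R]_m => z 0 i)
    (fun r : R => r ^+ 2)); first exact: coord_continuous.
exact: exprn_continuous.
Qed.

(** On the unit sphere every coordinate of [z] is at most 1 in absolute value, so the matrix entries
    of [f] bound each coordinate of [f z]. This makes the real-valued [sup] in [opnorm] a genuine
    supremum. *)
Lemma opnorm_has_ubound (R : realType) m n (f : {linear 'rV[R]_m -> 'rV[R]_n}) :
  has_ubound [set enorm (f z) | z in [set z : 'rV[R]_m | enorm z = 1]].
Proof.
exists (Num.sqrt (\sum_(i < n) (\sum_(j < m) `|lin1_mx f j i|) ^+ 2)).
move=> _ [z z1 <-]; rewrite ler_wsqrtr//; apply: ler_sum => i _.
rewrite -mul_rV_lin1 -[leLHS]real_normK ?num_real//.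
rewrite ler_sqr ?nnegrE//; last first.
  exact: sumr_ge0.
rewrite mxE (le_trans (ler_norm_sum _ _ _))//; apply: ler_sum => j _.
by rewrite normrM ler_piMl// -z1 normr_coord_le_enorm.
Qed.

Lemma opnorm_ge0 (R : realType) m n (f : {linear 'rV[R]_m -> 'rV[R]_n}) :
  0 <= opnorm f.
Proof.
rewrite /opnorm; have := opnorm_has_ubound f.
set S := [set _ | _ in _] => ubS.
(* The unit sphere is empty when [m = 0]; then [sup] takes its default value 0. *)
have [->|/set0P[r Sr]] := eqVneq S set0; first by rewrite sup0.
apply: le_trans (ub_le_sup ubS Sr).
by have [z _ <-] := Sr; exact: enorm_ge0.
Qed.

Lemma enorm_le_opnorm (R : realType) m n (f : {linear 'rV[R]_m -> 'rV[R]_n}) z :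
  enorm (f z) <= opnorm f * enorm z.
Proof.
have [->|z0] := eqVneq z 0.
  by rewrite linear0 !enorm0 mulr0.
have e0 := enorm_gt0 z0.
rewrite -ler_pdivrMr// mulrC -[_^-1]gtr0_norm ?invr_gt0// -enormZ -linearZ.
apply: ub_le_sup; first exact: opnorm_has_ubound.
exists ((enorm z)^-1 *: z) => //=.
by rewrite enormZ gtr0_norm ?invr_gt0// mulVf ?gt_eqF.
Qed.

Lemma enorm_delta (R : realType) m (i : 'I_m) :
  enorm (delta_mx 0 i : 'rV[R]_m) = 1.
Proof.
rewrite /enorm (bigD1 i)//= big1 ?addr0 => [|j ji]; rewrite mxE eqxx ?eqxx.
  by rewrite expr1n sqrtr1.
by rewrite (negbTE ji) expr0n.
Qed.

(** Positivity of [m] supplies a unit vector. Over an empty sphere [opnorm] would be 0, whereas [C]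
    could be negative. *)
Lemma opnorm_le (R : realType) m n (f : 'rV[R]_m -> 'rV[R]_n) (C : R) :
  (0 < m)%N -> (forall z, enorm z = 1 -> enorm (f z) <= C) -> opnorm f <= C.
Proof.
move=> m0 fC; apply: ge_sup => [|_ [z z1 <-]]; last exact: fC.
pose v : 'rV[R]_m := delta_mx 0 (Ordinal m0).
by exists (enorm (f v)), v => //; exact: enorm_delta.
Qed.

(** * Limits of matrices, and directional derivatives as limits of quotients *)

Lemma cvg_mx (R : realType) (T : Type) (F : set_system T) {FF : Filter F} p q
    (g : T -> 'M[R]_(p, q)) (M : 'M[R]_(p, q)) :
  (forall i j, (fun t => g t i j) @ F --> M i j) -> g @ F --> M.
Proof.
move=> gM A [B MB BA].
have : \forall t \near F, forall i j, B i j (g t i j).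
  apply: filter_forall => i; apply: filter_forall => j; exact: gM (MB i j).
by apply: filterS => t Bt; exact: BA.
Qed.

Lemma cvg_mulmx (R : realType) (T : Type) (F : set_system T) {FF : Filter F}
    p q r (g : T -> 'M[R]_(p, q)) (h : T -> 'M[R]_(q, r))
    (M : 'M[R]_(p, q)) (N : 'M[R]_(q, r)) :
  g @ F --> M -> h @ F --> N -> (fun t => g t *m h t) @ F --> M *m N.
Proof.
move=> gM hN; apply: cvg_mx => i j; rewrite mxE.
under eq_fun do rewrite mxE.
apply: cvg_sum => k; apply: cvgM.
  exact: (@cvg_comp _ _ _ g (fun A : 'M[R]_(p, q) => A i k) _ _ _ gM
    (@coord_continuous R p q i k M)).
exact: (@cvg_comp _ _ _ h (fun A : 'M[R]_(q, r) => A k j) _ _ _ hN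
  (@coord_continuous R q r k j N)).
Qed.

Lemma cvg_ray (R : realType) m (x v : 'rV[R]_m) :
  h *: v + x @[h --> (0 : R)] --> x.
Proof.
have {2}<- : 0 *: v + x = x by rewrite scale0r add0r.
by apply: cvgD; [exact: scalel_continuous|exact: cvg_cst].
Qed.

(** The lower limit is the supremum, over the sets of [F], of the infima of [g]; a number strictly
    below it lies strictly below one of these infima. *)
Lemma limf_einf_gt (R : realType) (T : topologicalType) (g : T -> R)
    (F : set_system T) {FF : Filter F} (c : R) :
  (c%:E < limf_einf (fun z => (g z)%:E) F)%E -> \forall z \near F, c < g z.
Proof.
rewrite limf_einfE => /ereal_sup_gt[_ [A FA <-] cA].
apply: filterS FA => z Az; rewrite -lte_fin (lt_le_trans cA)//.
by apply: ereal_inf_lbound; exists z.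
Qed.

(** This is the local form of B_f <= L_f. For a unit vector [v] and [c < Om x x], the lower limit
    puts [c] below [Om x z] for [z] near [x], so [c] times the difference quotients along [v] stays
    below [L]. First the step tends to 0, then [c] tends to [Om x x]. *)
Lemma diag_opnorm_le (R : realType) m n (D : set 'rV[R]_m)
    (f : 'rV[R]_m -> 'rV[R]_n) (Om : 'rV[R]_m -> 'rV[R]_m -> R) (L : R) x :
  (0 < m)%N -> open D -> D x -> differentiable f x -> 0 < Om x x ->
  ((Om x x)%:E <= limf_einf (fun z => (Om x z)%:E) (within D (dnbhs x)))%E ->
  (forall y, D y -> x <> y ->
    Om x y * (enorm (f x - f y) / enorm (x - y)) <= L) ->
  Om x x * opnorm ('d f x) <= L.
Proof.
move=> m0 oD Dx dfx Oxx Oinf OL.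
rewrite mulrC -ler_pdivlMr//; apply: opnorm_le => // v v1.
rewrite ler_pdivlMr// mulrC.
have v0 := enorm1_neq0 v1.
have Lc c : c < Om x x -> c * enorm ('d f x v) <= L.
  move=> cO.
  have nD : \forall z \near x, D z by exact: open_nbhs_nbhs.
  have nO : \forall z \near x, z != x -> D z -> c < Om x z.
    have : (c%:E < limf_einf (fun z => (Om x z)%:E) (within D (dnbhs x)))%E.
      by rewrite (lt_le_trans _ Oinf)// lte_fin.
    by move/limf_einf_gt; rewrite !near_withinE.
  have hx := @cvg_ray R m x v.
  have := @diff_derivable _ _ _ f x v dfx.
  rewrite /derivable -deriveE// /derive => cvf.
  have cvE := cvg_comp _ _ cvf (@enorm_continuous R n _).
  apply: (cvgr_to_le (cvgM (cvg_cst c) cvE)).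
  rewrite near_withinE /=; near=> h.
  have Dz : D (h *: v + x) by near: h; exact: hx nD.
  have cz : h *: v + x != x -> D (h *: v + x) -> c < Om x (h *: v + x).
    by near: h; exact: hx nO.
  set z := h *: v + x in Dz cz * => h0.
  have zx : z != x by rewrite -subr_eq0 addrK scaler_eq0 negb_or h0.
  have {}cz := cz zx Dz.
  apply: le_trans (OL z Dz _); last by move=> xz; rewrite xz eqxx in zx.
  (* As [z - x = h *: v] with [v] of length 1, the quotient is the length of the difference quotient
     that converges to ['d f x v]. *)
  have -> : enorm (f x - f z) / enorm (x - z) =
      enorm (h^-1 *: ((f \o shift x) (h *: v) - f x)).
    by rewrite enormB (enormB x) /z addrK !enormZ v1 mulr1 normfV mulrC.
  by rewrite ler_wpM2r ?enorm_ge0// ltW.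
(* If the directional derivative vanishes, only [0 <= L] remains, which is the case [c = 0]. *)
have [->|E0] := eqVneq (enorm ('d f x v)) 0.
  by rewrite mulr0; have := Lc 0 Oxx; rewrite mul0r.
have {}E0 : 0 < enorm ('d f x v) by rewrite lt_neqAle eq_sym E0 enorm_ge0.
apply/ler_addgt0Pr => e e0; rewrite -lerBlDr.
(* The loss [e] is absorbed by taking [c = Om x x - e / enorm ('d f x v)]. *)
have -> : Om x x * enorm ('d f x v) - e =
    (Om x x - e / enorm ('d f x v)) * enorm ('d f x v).
  by rewrite mulrBl divfK ?gt_eqF.
by apply: Lc; rewrite ltrBlDr ltrDl divr_gt0.
Unshelve. all: by end_near. Qed.

(** * Integrals over intervals and over partitions *)

Local Notation mu := (@lebesgue_measure _).

(** End points have measure zero. This is how the uncontrolled values of the derivative at break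
    points are discarded. *)
Lemma integrable_itv_cc_oo (R : realType) (F : R -> R) (c d : R) :
  mu.-integrable `]c, d[ (EFin \o F) -> mu.-integrable `[c, d] (EFin \o F).
Proof.
move=> /integrableP[mF iF]; apply/integrableP; split.
  by apply/emeasurable_fun_itv_obnd_cbndP/emeasurable_fun_itv_bndo_bndcP.
rewrite integral_itv_bndoo//; exact: measurableT_comp.
Qed.

Lemma Rintegral_itv_cc_oo (R : realType) (F : R -> R) (c d : R) :
  mu.-integrable `]c, d[ (EFin \o F) ->
  \int[mu]_(t in `[c, d]) F t = \int[mu]_(t in `]c, d[) F t.
Proof. by move=> /measurable_int iF; rewrite /Rintegral integral_itv_bndoo. Qed.

Lemma integrable_setU (d : measure_display) (T : measurableType d)
    (R : realType) (nu : {measure set T -> \bar R}) (A B : set T)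
    (F : T -> \bar R) :
  measurable A -> measurable B -> [disjoint A & B] ->
  nu.-integrable A F -> nu.-integrable B F -> nu.-integrable (A `|` B) F.
Proof.
move=> mA mB AB /integrableP[mFA iFA] /integrableP[mFB iFB]; apply/integrableP.
have mF : measurable_fun (A `|` B) F by exact/measurable_funU.
split => //; rewrite ge0_integral_setU//; first exact: lte_add_pinfty.
exact: measurableT_comp.
Qed.

Lemma Rintegral_itv_split (R : realType) (F : R -> R) (a b c : R) :
  a <= c -> c <= b ->
  mu.-integrable `[a, c] (EFin \o F) -> mu.-integrable `[c, b] (EFin \o F) ->
  mu.-integrable `[a, b] (EFin \o F) /\
  \int[mu]_(t in `[a, b]) F t =
    \int[mu]_(t in `[a, c]) F t + \int[mu]_(t in `[c, b]) F t.
Proof.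
move=> ac cb Fac Fcb.
(* The closed intervals share the point [c], so it is removed from the second one to get a disjoint
   union. *)
have Fcb' : mu.-integrable `]c, b] (EFin \o F).
  by apply: integrableS Fcb => //; apply: subset_itvr; rewrite bnd_simp.
have E : [set` `[a, b]] = `[a, c] `|` `]c, b].
  by rewrite -itv_bndbnd_setU// bnd_simp.
have Fab : mu.-integrable `[a, b] (EFin \o F).
  rewrite E; apply: integrable_setU => //.
  apply/disj_setPS => t [] /=; rewrite !in_itv/= => /andP[_ tc].
  by rewrite ltNge tc.
split=> //; apply/eqP; rewrite addrC -subr_eq; apply/eqP.
by rewrite Rintegral_itvB ?bnd_simp// Rintegral_itv_obnd_cbnd.
Qed.

(** Induction on the break points, splitting off the first interval. Integrability is carried along
    because additivity of the integral requires it. *)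
Lemma le_Rintegral_partition (R : realType) (F G : R -> R) (K a b : R) s :
  itv_partition a b s ->
  (forall i, (i < size s)%N ->
    let I := `[nth a (a :: s) i, nth a (a :: s) i.+1] in
    [/\ mu.-integrable [set` I] (EFin \o F),
        mu.-integrable [set` I] (EFin \o G) &
        \int[mu]_(t in [set` I]) F t <= K * \int[mu]_(t in [set` I]) G t]) ->
  [/\ mu.-integrable `[a, b] (EFin \o F), mu.-integrable `[a, b] (EFin \o G) &
      \int[mu]_(t in `[a, b]) F t <= K * \int[mu]_(t in `[a, b]) G t].
Proof.
elim: s a => [|c s ih] a abs FG.
  (* With no break points [a = b], and both integrals are over a single point. *)
  rewrite -(itv_partition_nil abs) set_itv1 !Rintegral_set1 mulr0; split => //.
    by rewrite -set_itv1; apply: integrable_itv_cc_oo; rewrite set_itvoo0;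
      exact: integrable_set0.
  by rewrite -set_itv1; apply: integrable_itv_cc_oo; rewrite set_itvoo0;
    exact: integrable_set0.
have cbs := itv_partition_cons abs.
have [iF iG FGac] := FG 0%N isT.
have [|jF jG FGcb] := ih c cbs.
  move=> i si; have := FG i.+1 si => /=.
  (* The default of [nth] changes from [a] to [c] when the first break point is dropped; all indices
     are in range. *)
  by rewrite !(set_nth_default c)//= ltnW.
have ac : a <= c by case: abs => /= /andP[/ltW].
have cb := itv_partition_le cbs.
have [kF ->] := Rintegral_itv_split ac cb iF jF.
have [kG ->] := Rintegral_itv_split ac cb iG jG.
by split => //; rewrite mulrDr lerD.
Qed.

(** * Images of piecewise C^1 curves and their weighted lengths *)

Lemma within_continuous_comp_open (X Y Z : topologicalType) (I : set X)
    (D : set Y) (g : X -> Y) (h : Y -> Z) :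
  open D -> (forall t, I t -> D (g t)) ->
  {within I, continuous g} -> {within D, continuous h} ->
  {within I, continuous (h \o g)}.
Proof.
move=> oD gD /subspace_continuousP cg.
rewrite continuous_open_subspace// => ch.
apply/subspace_continuousP => t It.
by apply: cvg_comp (cg t It) (ch _ _); rewrite inE; exact: gD.
Qed.

Lemma derive1_comp_diff (R : realType) m n (g : R -> 'rV[R]_m)
    (f : 'rV[R]_m -> 'rV[R]_n) t :
  derivable g t 1 -> differentiable f (g t) ->
  derivable (f \o g) t 1 /\ derive1 (f \o g) t = 'd f (g t) (derive1 g t).
Proof.
move=> /derivable1_diffP dg df.
have dfg : differentiable (f \o g) t by exact: differentiable_comp.
split; first exact/derivable1_diffP.
have E := @diff_comp _ _ _ _ g f t dg df.
by rewrite (derive1E' dfg) (derive1E' dg) E.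
Qed.

Lemma C1_piece_comp (R : realType) m n (D : set 'rV[R]_m) (D' : set 'rV[R]_n)
    (f : 'rV[R]_m -> 'rV[R]_n) (g : R -> 'rV[R]_m) (c d : R) :
  open D -> C1_map D D' f -> (forall t, t \in `[c, d] -> D (g t)) ->
  {within `[c, d], continuous g} -> C1_piece c d g -> C1_piece c d (f \o g).
Proof.
move=> oD [_ df cJ] gD cg [dg [h ch gh]].
have gDoo t : t \in `]c, d[ -> D (g t) by move/subset_itv_oo_cc; exact: gD.
split=> [t tcd|].
  exact: (derive1_comp_diff (dg t tcd) (df _ (gDoo t tcd))).1.
(* The chain rule, with [h] in place of the derivative of [g], gives an extension continuous up to
   the end points. Vectors are rows, so the Jacobian acts on the right. *)
exists (fun t => h t *m jacobian f (g t)) => [|t tcd].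
  have cJg : {within `[c, d], continuous (jacobian f \o g)}.
    exact: within_continuous_comp_open oD _ cg cJ.
  move/subspace_continuousP in cJg; move/subspace_continuousP in ch.
  apply/subspace_continuousP => t tcd.
  exact: cvg_mulmx (ch t tcd) (cJg t tcd).
rewrite (derive1_comp_diff (dg t tcd) (df _ (gDoo t tcd))).2.
by rewrite gh// /jacobian mul_rV_lin1.
Qed.

(** Inside the interval the derivative equals its extension [h], for which the integrand is
    continuous on a compact interval; the end points do not matter. *)
Lemma integrable_speed (R : realType) m (D : set 'rV[R]_m) (w : 'rV[R]_m -> R)
    (g : R -> 'rV[R]_m) (c d : R) :
  open D -> {within D, continuous w} -> (forall t, t \in `[c, d] -> D (g t)) ->
  {within `[c, d], continuous g} -> C1_piece c d g ->
  mu.-integrable `[c, d] (EFin \o (fun t => w (g t) * enorm (derive1 g t))).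
Proof.
move=> oD cw gD cg [_ [h ch gh]]; apply: integrable_itv_cc_oo.
suff : mu.-integrable `]c, d[ (EFin \o (fun t => w (g t) * enorm (h t))).
  apply: eq_integrable => //.
  by move=> t; rewrite inE /= => /gh ->.
suff : mu.-integrable `[c, d] (EFin \o (fun t => w (g t) * enorm (h t))).
  by apply: integrableS => //; exact: subset_itv_oo_cc.
apply: continuous_compact_integrable; first exact: segment_compact.
have cwg := within_continuous_comp_open oD gD cg cw.
move/subspace_continuousP in cwg; move/subspace_continuousP in ch.
apply/subspace_continuousP => t tcd; apply: cvgM; first exact: cwg.
exact: cvg_comp (ch t tcd) (@enorm_continuous R m (h t)).
Qed.

(** The chain rule and [enorm_le_opnorm] compare the integrands pointwise inside each piece;
    integrating and adding the pieces compares the lengths. *)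
Lemma weighted_length_comp (R : realType) m n (D : set 'rV[R]_m)
    (D' : set 'rV[R]_n) (w : 'rV[R]_m -> R) (w' : 'rV[R]_n -> R)
    (f : 'rV[R]_m -> 'rV[R]_n) (K : R) x y a b (g : R -> 'rV[R]_m) :
  open D -> open D' -> weight_function D w -> weight_function D' w' ->
  C1_map D D' f ->
  (forall z, D z -> w' (f z) / w z * opnorm ('d f z) <= K) ->
  curve_connecting D x y a b g ->
  curve_connecting D' (f x) (f y) a b (f \o g) /\
  weighted_length w' a b (f \o g) <= K * weighted_length w a b g.
Proof.
move=> oD oD' [w0 cw] [w'0 cw'] C1f fK [ab [cg [s abs pg]] gD gx gy].
have [fD df _] := C1f.
have cf : {within D, continuous f}.
  rewrite continuous_open_subspace// => z; rewrite inE => Dz.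
  exact/differentiable_continuous/df.
have cfg : {within `[a, b], continuous (f \o g)}.
  exact: within_continuous_comp_open oD gD cg cf.
have sub i : (i < size s)%N ->
    [set` `[nth a (a :: s) i, nth a (a :: s) i.+1]] `<=` `[a, b].
  (* The indices are in range, so the default of [nth] may be changed to [b], as in the lemmas that
     place break points between [a] and [b]. *)
  move=> si; rewrite !(set_nth_default b)//=; last by rewrite ltnS ltnW.
  apply: subset_itv; rewrite bnd_simp.
    exact: (itv_partition_nth_ge (ltnW si) abs).
  exact: (@itv_partition_nth_le _ _ _ _ _ i.+1 _ abs).
have gDi i : (i < size s)%N -> forall t,
    t \in `[nth a (a :: s) i, nth a (a :: s) i.+1] -> D (g t).
  by move=> si t /(sub i si)/gD.
have pfg i : (i < size s)%N ->
    C1_piece (nth a (a :: s) i) (nth a (a :: s) i.+1) (f \o g).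
  move=> si; apply: (C1_piece_comp oD C1f (gDi i si) _ (pg i si)).
  exact: continuous_subspaceW (sub i si) cg.
split.
  split => //; first by split => //; exists s.
  - by move=> t /gD /fD.
  - by rewrite /= gx.
  - by rewrite /= gy.
pose F t := w' ((f \o g) t) * enorm (derive1 (f \o g) t).
pose G t := w (g t) * enorm (derive1 g t).
suff [] : [/\ mu.-integrable `[a, b] (EFin \o F),
    mu.-integrable `[a, b] (EFin \o G) &
    \int[mu]_(t in `[a, b]) F t <= K * \int[mu]_(t in `[a, b]) G t] by [].
apply: (le_Rintegral_partition abs) => i si.
have := sub i si; have := gDi i si; have := pg i si; have := pfg i si.
move: (nth a (a :: s) i) (nth a (a :: s) i.+1) => c d pcfg pcg Dcd cd I.
have iF : mu.-integrable `[c, d] (EFin \o F).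
  apply: integrable_speed oD' cw' _ _ pcfg; first by move=> t /Dcd /fD.
  exact: continuous_subspaceW cd cfg.
have iG : mu.-integrable `[c, d] (EFin \o G).
  apply: integrable_speed oD cw Dcd _ pcg.
  exact: continuous_subspaceW cd cg.
have oocc : [set` `]c, d[] `<=` `[c, d] by exact: subset_itv_oo_cc.
have iF' : mu.-integrable `]c, d[ (EFin \o F) by exact: integrableS iF.
have iG' : mu.-integrable `]c, d[ (EFin \o G) by exact: integrableS iG.
split => //.
(* The chain rule is available only inside the piece, hence the passage to the open interval. *)
rewrite /I (Rintegral_itv_cc_oo iF') (Rintegral_itv_cc_oo iG').
rewrite -RintegralZl//.
apply: le_Rintegral => //.
  exact: (@integrableZl _ _ _ _ _ _ K _ iG').
move=> t tcd; have Dgt : D (g t) by apply: Dcd; exact: oocc.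
have [dg _] := pcg.
rewrite /F /G (derive1_comp_diff (dg t tcd) (df _ Dgt)).2 /=.
apply: le_trans (ler_wpM2l (ltW (w'0 _ (fD _ Dgt))) (enorm_le_opnorm _ _)) _.
rewrite !mulrA ler_wpM2r ?enorm_ge0//.
by have := fK _ Dgt; rewrite mulrAC ler_pdivrMr// w0.
Qed.

(** * Comparison of the weighted distances *)

Lemma weighted_length_ge0 (R : realType) m (D : set 'rV[R]_m)
    (w : 'rV[R]_m -> R) x y a b g :
  weight_function D w -> curve_connecting D x y a b g ->
  0 <= weighted_length w a b g.
Proof.
move=> [w0 _] [_ _ gD _ _]; apply: Rintegral_ge0 => t tab.
by rewrite mulr_ge0 ?enorm_ge0// ltW// w0//; exact: gD.
Qed.

Lemma wdist_le (R : realType) m (D : set 'rV[R]_m) (w : 'rV[R]_m -> R)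
    x y a b g :
  weight_function D w -> curve_connecting D x y a b g ->
  wdist D w x y <= weighted_length w a b g.
Proof.
move=> ww gxy; apply: ge_inf; last by exists a, b, g.
by exists 0 => _ [a' [b' [g' [g'xy ->]]]]; exact: weighted_length_ge0 g'xy.
Qed.

(** The image under [f] of any curve from [x] to [y] competes in the infimum defining the distance
    in [D']; taking the infimum over the original curves gives the bound. *)
Lemma wdist_ratio_le (R : realType) m n (D : set 'rV[R]_m)
    (D' : set 'rV[R]_n) (w : 'rV[R]_m -> R) (w' : 'rV[R]_n -> R)
    (f : 'rV[R]_m -> 'rV[R]_n) (K : R) x y :
  open D -> open D' -> weight_function D w -> weight_function D' w' ->
  C1_map D D' f -> 0 <= K ->
  (forall z, D z -> w' (f z) / w z * opnorm ('d f z) <= K) ->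
  wdist D' w' (f x) (f y) / wdist D w x y <= K.
Proof.
move=> oD oD' ww ww' C1f K0 fK.
have len a b g : curve_connecting D x y a b g ->
    wdist D' w' (f x) (f y) <= K * weighted_length w a b g.
  move=> gxy.
  have [fg] := weighted_length_comp oD oD' ww ww' C1f fK gxy.
  exact/le_trans/wdist_le.
rewrite {2}/wdist; set S := [set l | _].
(* The junk value 0 of [inf set0] and of the division by 0 makes the ratio 0. *)
have [S0|/set0P S0] := eqVneq S set0; first by rewrite S0 inf0 invr0 mulr0.
have : 0 <= inf S.
  apply: lb_le_inf => // _ [a [b [g [gxy ->]]]].
  exact: weighted_length_ge0 gxy.
rewrite le_eqVlt => /predU1P[<-|infS]; first by rewrite invr0 mulr0.
rewrite ler_pdivrMr//.
(* Passing to the infimum divides by [K]. If [K = 0], a single curve already shows that the distance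
   of the images is at most 0. *)
move: K0; rewrite le_eqVlt => /predU1P[K0|K0].
  have [_ [a [b [g [gxy _]]]]] := S0.
  by have := len _ _ _ gxy; rewrite -K0 !mul0r.
rewrite mulrC -ler_pdivrMr//; apply: lb_le_inf => // _ [a [b [g [gxy ->]]]].
by rewrite ler_pdivrMr// mulrC; exact: len gxy.
Qed.

(** * Finiteness and equality of the two suprema *)

Lemma open_ex_neq (R : realType) m (D : set 'rV[R]_m) x :
  (0 < m)%N -> open D -> D x -> exists2 y, D y & x <> y.
Proof.
move=> m0 oD Dx; pose v : 'rV[R]_m := delta_mx 0 (Ordinal m0).
have v0 : v != 0 := enorm1_neq0 (enorm_delta _ _).
have nD : \forall z \near x, D z by exact: open_nbhs_nbhs.
have hx := @cvg_ray R m x v.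
have : \forall h \near (0 : R)^', D (h *: v + x) /\ h != 0.
  rewrite near_withinE; near=> h => h0; split=> //.
  by near: h; exact: hx nD.
move/filter_ex => [h [Dh h0]]; exists (h *: v + x) => // /esym/eqP.
by rewrite -subr_eq0 addrK scaler_eq0 (negbTE h0) (negbTE v0).
Unshelve. all: by end_near. Qed.

Unset Implicit Arguments.

Theorem lemma2p1 (R : realType) (m n : nat) (m_gt0 : (0 < m)%N)
    (n_gt0 : (0 < n)%N)
    (D : set 'rV[R]_m) (D' : set 'rV[R]_n)
    (w : 'rV[R]_m -> R) (w' : 'rV[R]_n -> R)
    (domD : is_domain D) (domD' : is_domain D')
    (weight_w : weight_function D w) (weight_w' : weight_function D' w')
    (f : 'rV[R]_m -> 'rV[R]_n) (C1f : C1_map D D' f)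
    (Om : 'rV[R]_m -> 'rV[R]_m -> R) (admOm : admissible D w D' w' f Om) :
  Bnum D w w' f \is a fin_num \/ Lnum D f Om \is a fin_num ->
  [/\ Bnum D w w' f \is a fin_num, Lnum D f Om \is a fin_num
    & Bnum D w w' f = Lnum D f Om].
Proof.
have [[x0 Dx0] oD _] := domD; have [_ oD' _] := domD'.
have [fD df _] := C1f; have [w0 _] := weight_w; have [w'0 _] := weight_w'.
have BL : Lnum D f Om \is a fin_num -> (Bnum D w w' f <= Lnum D f Om)%E.
  move=> Lfin; apply: ge_ereal_sup => _ [x Dx <-].
  rewrite -(fineK Lfin) lee_fin -(admissible_diag admOm Dx).
  apply: (@diag_opnorm_le _ _ _ D) => //; first exact: df.
  - exact: (admissible_gt0 admOm Dx Dx).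
  - exact: (admissible_liminf admOm Dx).
  - move=> y Dy xy; rewrite -lee_fin fineK//.
    by apply: ereal_sup_ubound; exists (x, y).
have LB : Bnum D w w' f \is a fin_num -> (Lnum D f Om <= Bnum D w w' f)%E.
  move=> Bfin; apply: ge_ereal_sup => _ [[x y] [/= Dx Dy xy] <-].
  have fB z : D z -> w' (f z) / w z * opnorm ('d f z) <= fine (Bnum D w w' f).
    by move=> Dz; rewrite -lee_fin fineK//; apply: ereal_sup_ubound; exists z.
  rewrite -(fineK Bfin) lee_fin.
  apply: le_trans (admissible_dist admOm Dx Dy xy) _.
  apply: (wdist_ratio_le _ _ oD oD' weight_w weight_w' C1f _ fB).
  (* The bound B_f is nonnegative because it dominates its term at [x0]. *)
  apply: le_trans (fB _ Dx0); rewrite mulr_ge0 ?opnorm_ge0// ltW// divr_gt0//.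
    exact/w'0/fD.
  exact: w0.
(* An extended supremum is [-oo] only over an empty set of reals. Once both suprema exceed [-oo], a
   finite upper bound makes them finite. *)
have Bgt : (-oo < Bnum D w w' f)%E.
  apply: (@lt_le_trans _ _ (w' (f x0) / w x0 * opnorm ('d f x0))%:E).
    exact: ltNyr.
  by apply: ereal_sup_ubound; exists x0.
(* A second point of [D] makes the set of quotients in L_f nonempty. *)
have [y0 Dy0 xy0] := open_ex_neq m_gt0 oD Dx0.
have Lgt : (-oo < Lnum D f Om)%E.
  apply: (@lt_le_trans _ _
    (Om x0 y0 * (enorm (f x0 - f y0) / enorm (x0 - y0)))%:E).
    exact: ltNyr.
  by apply: ereal_sup_ubound; exists (x0, y0).
have fin_le (u v : \bar R) : (-oo < u)%E -> (u <= v)%E -> v \is a fin_num ->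
    u \is a fin_num.
  move=> u0 uv /fin_numPlt/andP[_ vy]; apply/fin_numPlt.
  by rewrite u0 (le_lt_trans uv vy).
move=> BLfin.
have [Bfin Lfin] : Bnum D w w' f \is a fin_num /\ Lnum D f Om \is a fin_num.
  case: BLfin => [Bfin|Lfin]; split => //.
    exact: fin_le Lgt (LB Bfin) Bfin.
  exact: fin_le Bgt (BL Lfin) Lfin.
by split => //; apply/le_anti; rewrite BL// LB.
Qed.
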